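(* Let $p$ be a prime number and let $P=AB$ be a finite $p$-group which is the product of two subgroups $A$ and $B$, such that $p^2$ does not divide $|x^P|$ for all $x\in A\cup B$. Then $P' \leqslant \Phi(P) \leqslant Z(P)$, $P'$ is elementary abelian and $|P'|\leq p^2$.
   Context: $P=AB$ means that $A,B$ are subgroups of $P$ and $P=\{ab : a\in A,\ b\in B\}$. For $x\in P$, $x^P=\{g^{-1}xg : g\in P\}$ is the conjugacy class of $x$ in $P$ and $|x^P|$ is its size. $P'$ is the derived subgroup, $\Phi(P)$ the Frattini subgroup and $Z(P)$ the centre of $P$. The trivial group counts as elementary abelian. *)

(* Defs.v *)
From mathcomp Require Import all_boot all_fingroup all_solvable.

Set Implicit Arguments.
Unset Strict Implicit.
Unset Printing Implicit Defensive.

(* Main.v *)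
(* The centraliser of each x in A :|: B has index at most p, so it contains the
   Frattini subgroup; hence Phi(P) is central, P has class at most 2 and P' is
   elementary abelian.  As A is a subgroup whose elements all have at most p
   conjugates, commutation gives a linear space of maps of rank at most 1 on
   P/Z(P), so these maps share either an image line or a kernel.  The second
   case also forces a common image line, because P is generated by A :|: B: an
   element w of A :|: B outside the common kernel H yields [a, P] = <[a, w]>,
   which lies in the line [w, P] for every a in A.  So [A, P], and likewise
   [B, P], has order at most p, while P' = [A, P][B, P]. *)

Require Import Defs.
From mathcomp Require Import all_boot all_fingroup all_solvable.

Set Implicit Arguments.
Unset Strict Implicit.
Unset Printing Implicit Defensive.

Local Open Scope group_scope.

(** The index of ['C_P[x]] is a power of [p] at most [p], so this centraliser is [P] or a maximal
    subgroup. *)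
Lemma Phi_sub_cent1 (gT : finGroupType) (p : nat) (P : {group gT}) (x : gT) :
  p.-group P -> prime p -> #|x ^: P| <= p -> 'Phi(P) \subset 'C[x].
Proof.
move=> pP p_pr; rewrite -index_cent1 => le_p.
have [k _ def_k]: exists2 k, k <= logn p #|P| & #|P : 'C_P[x]| = (p ^ k)%N.
  by apply/(dvdn_pfactor _ _ p_pr); rewrite -(card_pgroup pP) dvdn_indexg.
move: le_p; rewrite def_k -[X in _ <= X]expn1 leq_exp2l ?prime_gt1 //.
case: k def_k => [|[|//]] def_k _.
  apply: subset_trans (Phi_sub P) _; apply: subset_trans (subsetIr P _).
  by rewrite -indexg_eq1 def_k.
apply: subset_trans (subsetIr P _); apply: Phi_sub_max.
by apply: p_index_maximal; rewrite ?subsetIl // def_k expn1.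
Qed.

Lemma commgMl_nil2 (gT : finGroupType) (P : {group gT}) (x y u : gT) :
    P^`(1) \subset 'Z(P) -> x \in P -> y \in P -> u \in P ->
  [~ x * y, u] = [~ x, u] * [~ y, u].
Proof.
move=> cl2 Px Py Pu; have /(subsetP cl2) Zxu := mem_commg Px Pu.
have cxuy : commute [~ x, u] y := centP (subsetP (subsetIr _ _) _ Zxu) y Py.
by rewrite commMgJ (conjg_fixP (introT commgP cxuy)).
Qed.

(* In class 2, [x^P = x[x, P]] contains the coset [x<[x, v]>], which already has
   [p] elements when [[x, v]] is nontrivial. *)
Lemma small_class_comm (gT : finGroupType) (p : nat) (P : {group gT})
    (x u v : gT) :
    P^`(1) \subset 'Z(P) -> p.-abelem P^`(1) ->
    x \in P -> u \in P -> v \in P -> #|x ^: P| <= p ->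
  [~ x, v] != 1 -> [~ x, u] \in <[[~ x, v]]>.
Proof.
move=> cl2 abelP' Px Pu Pv le_p nt_xv.
have P'xv := mem_commg Px Pv.
have cvxv : commute v [~ x, v].
  by apply: commute_sym; have /setIP[_ /centP/(_ v Pv)] := subsetP cl2 _ P'xv.
have sub_class: x *: <[[~ x, v]]> \subset x ^: P.
  apply/subsetP=> _ /lcosetP[_ /cycleP[k ->] ->].
  by rewrite -commgX // -conjg_mulR memJ_class ?groupX.
have: x ^ u \in x *: <[[~ x, v]]>.
  have /eqP->: x *: <[[~ x, v]]> == x ^: P.
    rewrite eqEcard sub_class card_lcoset.
    by rewrite -orderE (abelem_order_p abelP' P'xv nt_xv).
  exact: memJ_class.
by rewrite mem_lcoset commgEl.
Qed.

(** As [x * y] and [y] have the same commutator with [v], both [[~ x * y, u]] and [[~ y, u]] lie in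
    [<[[~ y, v]]>]; their quotient is [[~ x, u]]. *)
Lemma small_class_comm_mul (gT : finGroupType) (p : nat) (P : {group gT})
    (x y u v : gT) :
    P^`(1) \subset 'Z(P) -> p.-abelem P^`(1) ->
    x \in P -> y \in P -> u \in P -> v \in P ->
    #|y ^: P| <= p -> #|(x * y) ^: P| <= p ->
  [~ x, v] = 1 -> [~ y, v] != 1 -> [~ x, u] \in <[[~ y, v]]>.
Proof.
move=> cl2 abelP' Px Py Pu Pv y_p xy_p xv1 nt_yv.
have xy_v : [~ x * y, v] = [~ y, v] by rewrite (commgMl_nil2 cl2) // xv1 mul1g.
have yu := small_class_comm cl2 abelP' Py Pu Pv y_p nt_yv.
rewrite -(groupMr _ yu) -(commgMl_nil2 cl2) // -xy_v.
by apply: (small_class_comm cl2 abelP'); rewrite ?groupM ?xy_v.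
Qed.

(* When [C] is not central, there are [a] in [C] and [w] in the generating set
   [S] with [[a, w]] nontrivial, and then [[C, P]] is generated by [[a, w]]. *)
Lemma card_small_class_commg (gT : finGroupType) (p : nat) (S : {set gT})
    (P C : {group gT}) :
    prime p -> P^`(1) \subset 'Z(P) -> p.-abelem P^`(1) -> <<S>> = P ->
    (forall x, x \in S -> #|x ^: P| <= p) -> C \subset S ->
  #|[~: C, P]| <= p.
Proof.
move=> p_pr cl2 abelP' defP small CS.
have SP : S \subset P by rewrite -defP subset_gen.
have [/commG1P->|] := boolP (C \subset 'C(P)).
  by rewrite cards1 prime_gt0.
rewrite -{1}defP cent_gen centsC => /subsetPn[w Sw].
rewrite -sub_cent1 => /subsetPn[a Ca not_cwa].
have Pw := subsetP SP w Sw; have sCP := subset_trans CS SP.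
have Pa := subsetP sCP a Ca.
have nt_aw : [~ a, w] != 1.
  by rewrite (sameP commgP cent1P).
have le_p : #|<[[~ a, w]]>| <= p.
  by rewrite -orderE (abelem_order_p abelP' (mem_commg Pa Pw) nt_aw).
apply: leq_trans le_p; apply: subset_leq_card.
rewrite gen_subG; apply/subsetP=> _ /imset2P[c u Cc Pu ->].
have Pc := subsetP sCP c Cc.
have smallC x : x \in C -> #|x ^: P| <= p by move/(subsetP CS)/small.
have [cw1|nt_cw] := eqVneq [~ c, w] 1.
  (* Here [c * a] lies in the subgroup [C], so its class is small too. *)
  by apply: (small_class_comm_mul cl2 abelP'); rewrite ?smallC ?groupM.
apply: subsetP (small_class_comm cl2 abelP' Pc Pu Pw (smallC c Cc) nt_cw).
(* Inverting moves [w] to the left, so that the small class of [w] applies. *)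
rewrite cycle_subG -groupV /= -cycleV !invgR.
apply: (small_class_comm cl2 abelP' Pw Pc Pa (small w Sw)).
by rewrite -invgR eq_invg1.
Qed.

Theorem theoremA (gT : finGroupType) (p : nat) (P A B : {group gT})
    (p_prime : prime p) (pP : p.-group P)
    (defP : P = A * B :> {set gT})
    (hcl : forall x : gT, x \in A :|: B -> ~~ (p ^ 2 %| #|x ^: P|)%N) :
  [/\ P^`(1) \subset 'Phi(P), 'Phi(P) \subset 'Z(P),
      p.-abelem P^`(1) & (#|P^`(1)| <= p ^ 2)%N].
Proof.
have sAP : A \subset P by rewrite defP mulG_subl.
have sBP : B \subset P by rewrite defP mulG_subr.
have gen_AB : <<A :|: B>> = P.
  by apply/eqP; rewrite eqEsubset gen_subG subUset sAP sBP {1}defP mul_subG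
    ?sub_gen ?subsetUl ?subsetUr.
have small x : x \in A :|: B -> #|x ^: P| <= p.
  move=> /hcl; have /p_natP[k ->] : p.-nat #|x ^: P|.
    by rewrite -index_cent1; apply: pnat_dvd (dvdn_indexg _ _) pP.
  rewrite dvdn_Pexp2l ?(prime_gt1 p_prime) // -ltnNge ltnS => le_k1.
  by rewrite -[X in _ <= X]expn1 leq_exp2l // prime_gt1.
have PhiZ : 'Phi(P) \subset 'Z(P).
  rewrite subsetI Phi_sub centsC -gen_AB gen_subG gen_AB.
  apply/subsetP=> x ABx.
  by rewrite -sub_cent1 (Phi_sub_cent1 pP p_prime (small x ABx)).
have [P'Phi Mho_Phi]: P^`(1) \subset 'Phi(P) /\ 'Mho^1(P) \subset 'Phi(P).
  by rewrite (Phi_joing pP) joing_subl joing_subr.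
have cl2 := subset_trans P'Phi PhiZ.
have abelP' : p.-abelem P^`(1).
  have cP'P : P^`(1) \subset 'C(P) := subset_trans cl2 (subsetIr _ _).
  have abP' : abelian P^`(1) := subset_trans cP'P (centS (der_sub 1 P)).
  have pP' := pgroupS (der_sub 1 P) pP.
  apply: abelemS (Ohm1_abelem pP' abP').
  rewrite /= (OhmE 1 pP') {1}derg1 gen_subG.
  apply/subsetP=> _ /imset2P[x y Px Py ->].
  have P'xy := mem_commg Px Py.
  rewrite mem_gen // !inE P'xy expn1 /=; apply/eqP.
  have cxyx : commute x [~ x, y].
    by apply: commute_sym; apply: (centP (subsetP cP'P _ P'xy)).
  (* In class 2, [[~ x, y] ^+ p] is [[~ x ^+ p, y]], and [x ^+ p] is central because it lies in
     ['Mho^1(P)]. *)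
  rewrite -commXg //; apply/eqP/commgP; apply: (centP _ y Py).
  apply: subsetP (subset_trans Mho_Phi (subset_trans PhiZ (subsetIr _ _))) _ _.
  by rewrite -[X in x ^+ X]expn1 (Mho_p_elt 1) // (mem_p_elt pP).
split=> //.
have defP' : P^`(1) = [~: A, P] * [~: B, P].
  rewrite derg1 {1}defP commMG //.
  exact: subset_trans sBP (commg_normr _ _).
have le_card : #|P^`(1)| <= #|[~: A, P]| * #|[~: B, P]|.
  by rewrite mul_cardG -defP' leq_pmulr ?cardG_gt0.
apply: leq_trans le_card _; rewrite -mulnn leq_mul //.
  exact: (card_small_class_commg p_prime cl2 abelP' gen_AB small (subsetUl _ _)).
exact: (card_small_class_commg p_prime cl2 abelP' gen_AB small (subsetUr _ _)).
Qed.
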